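(* Let $\lambda$ be a nonzero real number and $r$ a positive integer. For every integer $n\ge 0$ (and every real $x$), $$\sum_{k=0}^{n}S_{J,\lambda}^{(2)}(n,k)\,C_{k}^{(r)}(x)=\sum_{k=0}^{n}\mathcal{E}_{k,\lambda}^{(r)}(x)\,S_{2,\lambda}(n,k).$$
   Context: All generating functions are formal power series in $t$ with real coefficients. For $x\in\mathbb{R}$: $(x)_0=1$, $(x)_n=x(x-1)\cdots(x-n+1)$ for $n\ge1$; $(x)_{0,\lambda}=1$, $(x)_{n,\lambda}=x(x-\lambda)\cdots(x-(n-1)\lambda)$ for $n\ge 1$. The degenerate exponential is $e_\lambda^x(t)=(1+\lambda t)^{x/\lambda}=\sum_{n\ge0}(x)_{n,\lambda}\frac{t^n}{n!}$, $e_\lambda(t)=e_\lambda^1(t)$ (and $e_\lambda^{-1}(t)$ is the case $x=-1$). The degenerate Stirling numbers of the second kind $S_{2,\lambda}(n,l)$ are defined by $(x)_{n,\lambda}=\sum_{l=0}^n S_{2,\lambda}(n,l)(x)_{l}$ (polynomial identity in $x$, $n\ge0$). The Jindalrae-Stirling numbers of the second kind are defined, for $k\ge0$, by $\frac{1}{k!}\left(e_\lambda(e_\lambda(t)-1)-1\right)^k=\sum_{n\ge k}S_{J,\lambda}^{(2)}(n,k)\frac{t^n}{n!}$. The type 2 degenerate Euler polynomials of order $r$ are defined by $\left(\frac{2}{e_\lambda(t)+e_\lambda^{-1}(t)}\right)^r e_\lambda^x(t)=\sum_{n\ge0}\mathcal{E}_{n,\lambda}^{(r)}(x)\frac{t^n}{n!}$.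 The type 2 Changhee polynomials of order $r$ are defined by $\left(\frac{2}{(1+t)+(1+t)^{-1}}\right)^r(1+t)^x=\sum_{n\ge0}C_n^{(r)}(x)\frac{t^n}{n!}$. *)

(* Defs.v *)
From HB Require Import structures.
From mathcomp Require Import all_boot all_order all_algebra.
From mathcomp Require Import boolp reals ring.

Set Implicit Arguments.
Unset Strict Implicit.
Unset Printing Implicit Defensive.

Import Order.TTheory GRing.Theory Num.Theory.

Local Open Scope ring_scope.

Record fps (R : Type) := Fps { fcoef : nat -> R }.

HB.instance Definition _ (R : Type) := gen_eqMixin (fps R).
HB.instance Definition _ (R : Type) := gen_choiceMixin (fps R).

Lemma fpsP (R : Type) (f g : fps R) : fcoef f =1 fcoef g -> f = g.
Proof. by case: f => f; case: g => g /= /funext ->. Qed.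

Definition fps0 (R : zmodType) : fps R := Fps (fun=> 0).
Definition fps_opp (R : zmodType) (f : fps R) : fps R :=
  Fps (fun n => - fcoef f n).
Definition fps_add (R : zmodType) (f g : fps R) : fps R :=
  Fps (fun n => fcoef f n + fcoef g n).

Lemma fps_addA (R : zmodType) : associative (@fps_add R).
Proof. by move=> f g h; apply: fpsP => n /=; rewrite addrA. Qed.
Lemma fps_addC (R : zmodType) : commutative (@fps_add R).
Proof. by move=> f g; apply: fpsP => n /=; rewrite addrC. Qed.
Lemma fps_add0 (R : zmodType) : left_id (@fps0 R) (@fps_add R).
Proof. by move=> f; apply: fpsP => n /=; rewrite add0r. Qed.
Lemma fps_addN (R : zmodType) :
  left_inverse (@fps0 R) (@fps_opp R) (@fps_add R).
Proof. by move=> f; apply: fpsP => n /=; rewrite addNr. Qed.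

HB.instance Definition _ (R : zmodType) := GRing.isZmodule.Build (fps R)
  (@fps_addA R) (@fps_addC R) (@fps_add0 R) (@fps_addN R).

Definition fps1 (R : pzRingType) : fps R := Fps (fun n => (n == 0%N)%:R).
Definition fps_mul (R : pzRingType) (f g : fps R) : fps R :=
  Fps (fun n => \sum_(i < n.+1) fcoef f i * fcoef g (n - i)%N).
Definition fps_scale (R : pzRingType) (a : R) (f : fps R) : fps R :=
  Fps (fun n => a * fcoef f n).

Definition fps_trunc (R : nzRingType) (N : nat) (f : fps R) : {poly R} :=
  \poly_(i < N.+1) fcoef f i.

Lemma coef_fps_trunc (R : nzRingType) (N n : nat) (f : fps R) :
  (n <= N)%N -> (fps_trunc N f)`_n = fcoef f n.
Proof. by move=> nN; rewrite coef_poly ltnS nN. Qed.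

Lemma fps_mul_trunc (R : nzRingType) (N n : nat) (f g : fps R) :
  (n <= N)%N -> fcoef (fps_mul f g) n = (fps_trunc N f * fps_trunc N g)`_n.
Proof.
move=> nN; rewrite coefM; apply: eq_bigr => i _.
by rewrite !coef_fps_trunc // (leq_trans _ nN) // ?leq_subr // -ltnS.
Qed.

Lemma fps_mulA (R : comNzRingType) : associative (@fps_mul R).
Proof.
move=> f g h; apply: fpsP => n.
transitivity (fps_trunc n f * (fps_trunc n g * fps_trunc n h))`_n.
  rewrite coefM; apply: eq_bigr => i _.
  have iN : (i <= n)%N by rewrite -ltnS.
  by rewrite coef_fps_trunc // (@fps_mul_trunc _ n) // leq_subr.
rewrite mulrA coefM; apply: eq_bigr => i _.
have iN : (i <= n)%N by rewrite -ltnS.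
by rewrite coef_fps_trunc ?leq_subr // (@fps_mul_trunc _ n).
Qed.

Lemma fps_mulC (R : comNzRingType) : commutative (@fps_mul R).
Proof.
by move=> f g; apply: fpsP => n; rewrite !(@fps_mul_trunc _ n) // mulrC.
Qed.

Lemma fps_mul1 (R : comNzRingType) : left_id (@fps1 R) (@fps_mul R).
Proof.
move=> f; apply: fpsP => n /=; rewrite big_ord_recl /= mul1r subn0.
by rewrite big1 ?addr0 // => i _; rewrite mul0r.
Qed.

Lemma fps_mulDl (R : comNzRingType) :
  left_distributive (@fps_mul R) (@fps_add R).
Proof.
move=> f g h; apply: fpsP => n /=; rewrite -big_split /=.
by apply: eq_bigr => i _; rewrite mulrDl.
Qed.

Lemma fps1_neq0 (R : comNzRingType) : fps1 R != 0.
Proof.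
apply/eqP => /(congr1 (fun f : fps R => fcoef f 0)) /= /eqP.
by rewrite oner_eq0.
Qed.

HB.instance Definition _ (R : comNzRingType) :=
  GRing.Zmodule_isComNzRing.Build (fps R)
    (@fps_mulA R) (@fps_mulC R) (@fps_mul1 R) (@fps_mulDl R) (@fps1_neq0 R).

Lemma fps_scaleA (R : comNzRingType) (a b : R) (f : fps R) :
  fps_scale a (fps_scale b f) = fps_scale (a * b) f.
Proof. by apply: fpsP => n /=; rewrite mulrA. Qed.
Lemma fps_scale1 (R : comNzRingType) : left_id 1 (@fps_scale R).
Proof. by move=> f; apply: fpsP => n /=; rewrite mul1r. Qed.
Lemma fps_scaleDr (R : comNzRingType) :
  right_distributive (@fps_scale R) +%R.
Proof. by move=> a f g; apply: fpsP => n /=; rewrite mulrDr. Qed.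
Lemma fps_scaleDl (R : comNzRingType) (f : fps R) :
  {morph (@fps_scale R)^~ f : a b / a + b}.
Proof. by move=> a b; apply: fpsP => n /=; rewrite mulrDl. Qed.

HB.instance Definition _ (R : comNzRingType) :=
  GRing.Zmodule_isLmodule.Build R (fps R)
    (@fps_scaleA R) (@fps_scale1 R) (@fps_scaleDr R) (@fps_scaleDl R).

(* The coefficients g_0, g_1, ... of 1/f are determined recursively by
   f_0 g_n + sum_(i < n) f_(n - i) g_i = [n = 0]. *)
Fixpoint fps_inv_seq (R : unitRingType) (f : fps R) (n : nat) : seq R :=
  if n is m.+1 then
    let s := fps_inv_seq f m in
    rcons s ((fcoef f 0)^-1 *
             ((m == 0%N)%:R - \sum_(i < m) fcoef f (m - i)%N * s`_i))
  else [::].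

Definition fps_unit (R : unitRingType) : {pred fps R} :=
  fun f => fcoef f 0 \is a GRing.unit.

Definition fps_inv (R : unitRingType) (f : fps R) : fps R :=
  if fcoef f 0 \is a GRing.unit then Fps (fun n => (fps_inv_seq f n.+1)`_n)
  else f.

Lemma size_fps_inv_seq (R : unitRingType) (f : fps R) (n : nat) :
  size (fps_inv_seq f n) = n.
Proof. by elim: n => //= n IHn; rewrite size_rcons IHn. Qed.

Lemma nth_fps_inv_seq (R : unitRingType) (f : fps R) (n i : nat) :
  (i < n)%N -> (fps_inv_seq f n)`_i = (fps_inv_seq f i.+1)`_i.
Proof.
elim: n => // n IHn; rewrite ltnS leq_eqVlt => /predU1P[-> //|lt_in].
by rewrite [in LHS]/= nth_rcons size_fps_inv_seq lt_in IHn.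
Qed.

Lemma fps_mulVx (R : comUnitRingType) :
  {in @fps_unit R, left_inverse 1 (@fps_inv R) *%R}.
Proof.
move=> f Uf; rewrite /fps_inv; have -> : fcoef f 0 \is a GRing.unit := Uf.
apply: fpsP => n; rewrite [LHS]/= big_ord_recr /= subnn.
rewrite nth_rcons size_fps_inv_seq ltnn eqxx mulrAC mulVr // mul1r.
rewrite addrC -[RHS]addr0 -addrA; congr (_ + _); apply/eqP.
rewrite addrC subr_eq0; apply/eqP; apply: eq_bigr => i _.
by rewrite mulrC (nth_fps_inv_seq _ (ltn_ord i)).
Qed.

Lemma fps_unitPl (R : comUnitRingType) (f g : fps R) :
  g * f = 1 -> fps_unit f.
Proof.
move=> /(congr1 (fun h : fps R => fcoef h 0)) /=.
rewrite big_ord_recl big_ord0 addr0 => gf1.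
by rewrite /fps_unit; apply/unitrPr; exists (fcoef g 0); rewrite mulrC.
Qed.

Lemma fps_inv_out (R : comUnitRingType) :
  {in [predC @fps_unit R], @fps_inv R =1 id}.
Proof. by move=> f /negbTE nUf; rewrite /fps_inv; have -> : (fcoef f 0 \is a GRing.unit) = false := nUf. Qed.

HB.instance Definition _ (R : comUnitRingType) :=
  GRing.ComNzRing_hasMulInverse.Build (fps R)
    (@fps_mulVx R) (@fps_unitPl R) (@fps_inv_out R).

Definition fpsX (R : nzRingType) : fps R := Fps (fun n => (n == 1%N)%:R).

(* Substitution f(g(t)); it is the usual composition of power series only when
   g has zero constant term, in which case g ^+ k has no term of degree n < k,
   so that the sum below is the full coefficient of t^n. *)
Definition fps_comp (R : comNzRingType) (f g : fps R) : fps R :=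
  Fps (fun n => \sum_(k < n.+1) fcoef f k * fcoef (g ^+ k) n).

(* The a_n such that f = sum_n a_n t^n / n!. *)
Definition egf_coef (R : nzRingType) (f : fps R) (n : nat) : R :=
  n`!%:R * fcoef f n.

Definition ffactr (R : pzRingType) (x : R) (n : nat) : R :=
  \prod_(i < n) (x - i%:R).

Definition dffactr (R : pzRingType) (lambda x : R) (n : nat) : R :=
  \prod_(i < n) (x - i%:R * lambda).

(* e_lambda^x(t) = (1 + lambda t)^(x / lambda) *)
Definition dexp (R : realType) (lambda x : R) : fps R :=
  Fps (fun n => dffactr lambda x n / n`!%:R).

(* (1 + t)^x for real x *)
Definition binom_fps (R : realType) (x : R) : fps R :=
  Fps (fun n => ffactr x n / n`!%:R).

Lemma dstirling2_exists (R : realType) (lambda : R) :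
  exists S : nat -> nat -> R, forall (n : nat) (x : R),
    dffactr lambda x n = \sum_(l < n.+1) S n l * ffactr x l.
Proof.
suff H n : exists s : nat -> R, forall x : R,
    dffactr lambda x n = \sum_(l < n.+1) s l * ffactr x l.
  by exists (fun n => sval (cid (H n))) => n x; case: (cid (H n)).
elim: n => [|n [s IHn]].
  by exists (fun=> 1) => x; rewrite big_ord1 /dffactr /ffactr !big_ord0 mulr1.
exists (fun l => (if l is m.+1 then s m else 0) +
  (if (l <= n)%N then s l * (l%:R - n%:R * lambda) else 0)) => x.
rewrite /dffactr big_ord_recr /= -/(dffactr lambda x n) IHn.
under [RHS]eq_bigr do rewrite mulrDl.
rewrite big_split /= [X in _ = X + _]big_ord_recl /= mul0r add0r.
rewrite [X in _ = _ + X]big_ord_recr /= ltnn mul0r addr0 -big_split /=.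
rewrite big_distrl /=; apply: eq_bigr => l _.
have -> : (l <= n)%N by rewrite -ltnS.
rewrite [in ffactr x (bump _ _)]/bump add1n /ffactr big_ord_recr /=.
by rewrite -/(ffactr x l); ring.
Qed.

(* S_{2,lambda}(n, l); for l <= n it is uniquely determined by
   [dstirling2P], and its values for l > n are irrelevant. *)
Definition dstirling2 (R : realType) (lambda : R) : nat -> nat -> R :=
  sval (cid (dstirling2_exists lambda)).

Lemma dstirling2P (R : realType) (lambda : R) (n : nat) (x : R) :
  dffactr lambda x n = \sum_(l < n.+1) dstirling2 lambda n l * ffactr x l.
Proof. exact: (svalP (cid (dstirling2_exists lambda))). Qed.

(* S_{J,lambda}^(2)(n, k) *)
Definition jstirling2 (R : realType) (lambda : R) (n k : nat) : R :=
  egf_coef (k`!%:R^-1 *: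
    (fps_comp (dexp lambda 1) (dexp lambda 1 - 1) - 1) ^+ k) n.

(* E_{n,lambda}^(r)(x) *)
Definition deuler2 (R : realType) (lambda : R) (r n : nat) (x : R) : R :=
  egf_coef ((2 / (dexp lambda 1 + dexp lambda (-1))) ^+ r * dexp lambda x) n.

(* C_n^(r)(x) *)
Definition changhee2 (R : realType) (r n : nat) (x : R) : R :=
  egf_coef ((2 / ((1 + fpsX R) + (1 + fpsX R)^-1)) ^+ r * binom_fps x) n.

(* Main.v *)
(* Put g = e_lambda(t) - 1 and let F be the exponential generating function of
   the C_k^(r)(x).  As (1 + t)^x becomes e_lambda^x(t) under t := g, the
   exponential generating function of the E_k^(r)(x) is F o g.  The left-hand
   side is n! [t^n] F o (g o g), and the right-hand side is n! [t^n] (F o g) o g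
   because sum_n S_2(n, l) t^n / n! = g^l / l!. *)
Require Import Defs.
From HB Require Import structures.
From mathcomp Require Import all_boot all_order all_algebra.
From mathcomp Require Import boolp reals ring.

Set Implicit Arguments.
Unset Strict Implicit.
Unset Printing Implicit Defensive.

Import Order.TTheory GRing.Theory Num.Theory.

Local Open Scope ring_scope.

(** * Algebra structure and coefficients of power series *)

Lemma fps_scaleAl (R : comNzRingType) (a : R) (f g : fps R) :
  a *: (f * g) = (a *: f) * g.
Proof.
by apply: fpsP => n /=; rewrite mulr_sumr; apply: eq_bigr => i _; rewrite mulrA.
Qed.

HB.instance Definition _ (R : comNzRingType) :=
  GRing.Lmodule_isLalgebra.Build R (fps R) (@fps_scaleAl R).

Lemma fps_scaleAr (R : comNzRingType) (a : R) (f g : fps R) :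
  a *: (f * g) = f * (a *: g).
Proof. by rewrite mulrC fps_scaleAl mulrC. Qed.

(** With this structure [horner_alg] evaluates polynomials at a power series, the tool used below to
    study composition. *)
HB.instance Definition _ (R : comNzRingType) :=
  GRing.Lalgebra_isAlgebra.Build R (fps R) (@fps_scaleAr R).

Lemma fcoef_sum (R : comNzRingType) (I : Type) (s : seq I) (P : pred I)
    (F : I -> fps R) (n : nat) :
  fcoef (\sum_(i <- s | P i) F i) n = \sum_(i <- s | P i) fcoef (F i) n.
Proof. by apply: (big_morph (fun f : fps R => fcoef f n)). Qed.

Lemma fcoefD (R : zmodType) (f g : fps R) (n : nat) :
  fcoef (f + g) n = fcoef f n + fcoef g n.
Proof. by []. Qed.

Lemma fcoefM (R : comNzRingType) (f g : fps R) (n : nat) :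
  fcoef (f * g) n = \sum_(i < n.+1) fcoef f i * fcoef g (n - i)%N.
Proof. by []. Qed.

(** * Composition with a series without constant term *)

Section Composition.
Variable R : comNzRingType.
Implicit Types f g h : fps R.

Lemma fcoef_exp_small g (k n : nat) :
  fcoef g 0 = 0 -> (n < k)%N -> fcoef (g ^+ k) n = 0.
Proof.
move=> g0; elim: k n => // k IHk n; rewrite ltnS exprS => le_nk /=.
rewrite big_ord_recl /= g0 mul0r add0r big1 // => i _.
rewrite IHk ?mulr0 // /bump; case: n i le_nk => [[]//|n] i.
by rewrite add1n subSS; apply: leq_ltn_trans; exact: leq_subr.
Qed.

(** Since [g ^+ k] has no term of degree below k, only the coefficients of [f] up to degree n
    matter, so a polynomial sharing them can be evaluated at [g] instead. *)
Lemma fcoef_compE g f (p : {poly R}) (n : nat) : fcoef g 0 = 0 ->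
  (forall k, (k <= n)%N -> p`_k = fcoef f k) ->
  fcoef (fps_comp f g) n = fcoef (horner_alg g p) n.
Proof.
(* [N] is large enough both to expand [p] in full and to include every k <= n. *)
move=> g0 pf; set N := maxn (size p) n.+1.
have -> : horner_alg g p = \sum_(k < N) p`_k *: g ^+ k.
  rewrite /horner_alg /horner_morph (@horner_coef_wide _ N); last first.
    exact: leq_trans (size_poly _ _) (leq_maxl _ _).
  by apply: eq_bigr => k _; rewrite coef_map /= mulr_algl.
rewrite fcoef_sum /=.
rewrite [RHS](bigID (fun k : 'I_N => (k < n.+1)%N)) /= [X in _ + X]big1 ?addr0.
  rewrite (big_ord_widen N (fun k => fcoef f k * fcoef (g ^+ k) n));
    last exact: leq_maxr.
  by apply: eq_bigr => k kn; rewrite pf.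
by move=> k; rewrite -leqNgt => nk; rewrite fcoef_exp_small ?mulr0.
Qed.

Lemma fps_comp1 g : fps_comp 1 g = 1.
Proof.
apply: fpsP => n /=; rewrite big_ord_recl /= mul1r.
by rewrite big1 ?addr0 // => i _; rewrite mul0r.
Qed.

Lemma fps_compD f1 f2 g :
  fps_comp (f1 + f2) g = fps_comp f1 g + fps_comp f2 g.
Proof.
apply: fpsP => n /=; rewrite -big_split /=.
by apply: eq_bigr => k _; rewrite mulrDl.
Qed.

Lemma fps_compB f1 f2 g :
  fps_comp (f1 - f2) g = fps_comp f1 g - fps_comp f2 g.
Proof.
apply: fpsP => n /=; rewrite -sumrB /=.
by apply: eq_bigr => k _; rewrite mulrBl.
Qed.

Lemma fps_compX g : fcoef g 0 = 0 -> fps_comp (fpsX R) g = g.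
Proof.
move=> g0; apply: fpsP => -[|n] /=; first by rewrite big_ord1 mul0r g0.
rewrite !big_ord_recl /= mul0r add0r mul1r expr1 big1 ?addr0 // => i _.
by rewrite mul0r.
Qed.

(** Up to degree n the factors may be replaced by their truncations, and evaluation of polynomials
    at [g] is multiplicative. *)
Lemma fps_compM f1 f2 g : fcoef g 0 = 0 ->
  fps_comp (f1 * f2) g = fps_comp f1 g * fps_comp f2 g.
Proof.
move=> g0; apply: fpsP => n.
rewrite (@fcoef_compE _ _ (fps_trunc n f1 * fps_trunc n f2)) //; last first.
  by move=> k kn; rewrite -fps_mul_trunc.
rewrite rmorphM /=; apply: eq_bigr => i _.
have le_in : (i <= n)%N by rewrite -ltnS.
have E f (j : nat) : (j <= n)%N ->
    fcoef (horner_alg g (fps_trunc n f)) j = fcoef (fps_comp f g) j.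
  move=> jn; rewrite (@fcoef_compE _ _ (fps_trunc n f)) // => k kj.
  by rewrite coef_fps_trunc // (leq_trans kj).
by congr (_ * _); apply: E => //; exact: leq_subr.
Qed.

Lemma fps_compXn f g (k : nat) : fcoef g 0 = 0 ->
  fps_comp (f ^+ k) g = fps_comp f g ^+ k.
Proof.
move=> g0; elim: k => [|k IHk]; first by rewrite !expr0 fps_comp1.
by rewrite !exprS fps_compM // IHk.
Qed.

(** As (h o g)^k = h^k o g, both sides are double sums of f_k [t^j]h^k [t^n]g^j, taken in exchanged
    order. *)
Lemma fps_compA f h g : fcoef h 0 = 0 -> fcoef g 0 = 0 ->
  fps_comp f (fps_comp h g) = fps_comp (fps_comp f h) g.
Proof.
move=> h0 g0; apply: fpsP => n /=.
under eq_bigr => k _ do rewrite -fps_compXn //= mulr_sumr.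
rewrite exchange_big /=; apply: eq_bigr => j _.
(* The ranges k <= j and k <= n give the same sum because h^k has no term of degree j < k. *)
rewrite (big_ord_widen n.+1 (fun k => fcoef f k * fcoef (h ^+ k) j)) //.
rewrite mulr_suml [RHS]big_mkcond /=; apply: eq_bigr => k _.
case: ltnP => [_|jk]; first by rewrite mulrA.
by rewrite fcoef_exp_small ?mul0r ?mulr0.
Qed.

End Composition.

Lemma fps_unitE (R : comUnitRingType) (f : fps R) :
  (f \is a GRing.unit) = (fcoef f 0 \is a GRing.unit).
Proof. by []. Qed.

Lemma fps_compV (R : comUnitRingType) (f g : fps R) :
  fcoef g 0 = 0 -> f \is a GRing.unit -> fps_comp f^-1 g = (fps_comp f g)^-1.
Proof.
move=> g0 Uf.
have E : fps_comp f g * fps_comp f^-1 g = 1.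
  by rewrite -fps_compM // divrr // fps_comp1.
have Uc : fps_comp f g \is a GRing.unit.
  by apply/unitrPr; exists (fps_comp f^-1 g).
by apply: (mulrI Uc); rewrite E divrr.
Qed.

(** * Recurrence and exponent law for the degenerate exponential *)

Section DegenerateExponential.
Variables (R : realType) (lambda : R).
Implicit Types x y : R.

Lemma natr_fact_neq0 (n : nat) : n`!%:R != 0 :> R.
Proof. by rewrite pnatr_eq0 -lt0n fact_gt0. Qed.

(** This is the differential equation (1 + lambda t) y' = x y, read on coefficients. *)
Lemma dexp_coefS x (n : nat) :
  n.+1%:R * fcoef (dexp lambda x) n.+1 =
  (x - n%:R * lambda) * fcoef (dexp lambda x) n.
Proof.
rewrite /= /dffactr big_ord_recr /= factS natrM invfM.
have n0 : n.+1%:R != 0 :> R by rewrite pnatr_eq0.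
by rewrite mulrCA mulVKf // [_ * (x - _)]mulrC mulrA.
Qed.

Lemma dexp_coef0 x : fcoef (dexp lambda x) 0 = 1.
Proof. by rewrite /= /dffactr big_ord0 fact0 divr1. Qed.

(* Both sides satisfy c_0 = 1 and
   (n + 1) c_(n+1) = (x + y - n lambda) c_n. *)
Lemma dexpD x y : dexp lambda (x + y) = dexp lambda x * dexp lambda y.
Proof.
apply: fpsP; elim=> [|n IHn].
  by rewrite fcoefM big_ord1 !dexp_coef0 mulr1.
have n0 : n.+1%:R != 0 :> R by rewrite pnatr_eq0.
apply: (mulfI n0); rewrite dexp_coefS {}IHn.
move: (dexp_coefS x) (dexp_coefS y).
move: (dexp lambda x) (dexp lambda y) => f g fS gS.
(* The Leibniz rule (f g)' = f' g + f g' on coefficients, from n + 1 = i + (n + 1 - i). *)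
have -> : n.+1%:R * fcoef (f * g) n.+1 =
    \sum_(i < n.+2) i%:R * fcoef f i * fcoef g (n.+1 - i)%N +
    \sum_(i < n.+2) fcoef f i * ((n.+1 - i)%:R * fcoef g (n.+1 - i)%N).
  rewrite fcoefM mulr_sumr -big_split; apply: eq_bigr => i _ /=.
  by rewrite natrB ?leq_ord //; ring.
rewrite [X in _ = X + _]big_ord_recl [X in _ = _ + X]big_ord_recr /=.
rewrite !mul0r add0r subnn mul0r mulr0 addr0 -big_split mulr_sumr.
apply: eq_bigr => i _ /=.
have le_in : (i <= n)%N by rewrite -ltnS.
(* The two factors add up: (x - i lambda) + (y - (n - i) lambda) = x + y - n lambda. *)
by rewrite /bump add1n subSS (subSn le_in) fS gS natrB //; ring.
Qed.

Lemma dexp0 : dexp lambda 0 = 1.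
Proof.
apply: fpsP => -[|n]; first exact: dexp_coef0.
by rewrite /= /dffactr big_ord_recl mul0r subr0 !mul0r.
Qed.

Lemma dexp_nat (m : nat) : dexp lambda m%:R = dexp lambda 1 ^+ m.
Proof.
elim: m => [|m IHm]; first by rewrite dexp0.
by rewrite exprS -IHm -dexpD -nat1r.
Qed.

Lemma dexpN1 : dexp lambda (-1) = (dexp lambda 1)^-1.
Proof.
have E : dexp lambda 1 * dexp lambda (-1) = 1 by rewrite -dexpD subrr dexp0.
have U : dexp lambda 1 \is a GRing.unit.
  by apply/unitrPr; exists (dexp lambda (-1)).
by apply: (mulrI U); rewrite E divrr.
Qed.

Lemma dexpB1_coef0 : fcoef (dexp lambda 1 - 1) 0 = 0.
Proof. by rewrite -[LHS]/(fcoef (dexp lambda 1) 0 - 1) dexp_coef0 subrr. Qed.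

End DegenerateExponential.

(** * Falling factorials and the binomial series *)

Lemma ffactr_nat (R : realType) (m k : nat) :
  ffactr (m%:R : R) k = (m ^_ k)%:R.
Proof.
elim: k => [|k IHk]; first by rewrite /ffactr big_ord0 ffactn0.
rewrite /ffactr big_ord_recr /= -/(ffactr (m%:R : R) k) IHk ffactnSr natrM.
have [km|mk] := leqP k m; first by rewrite natrB.
by rewrite ffact_small // !mul0r.
Qed.

(** The system is triangular: at m = l the terms of index above l vanish and (l)_l = l! is nonzero,
    so the coefficients are recovered one after another. *)
Lemma ffactr_free (R : realType) (n : nat) (c d : nat -> R) :
  (forall m : nat, \sum_(l < n.+1) c l * ffactr m%:R l =
                   \sum_(l < n.+1) d l * ffactr m%:R l) ->
  forall l, (l <= n)%N -> c l = d l.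
Proof.
move=> E; elim/ltn_ind => l IHl ln; have := E l.
have lt_ln : (l < n.+1)%N by [].
rewrite (bigD1 (Ordinal lt_ln)) // [RHS](bigD1 (Ordinal lt_ln)) //=.
have -> : \sum_(i < n.+1 | i != Ordinal lt_ln) c i * ffactr l%:R i =
          \sum_(i < n.+1 | i != Ordinal lt_ln) d i * ffactr l%:R i.
  apply: eq_bigr => i; rewrite -val_eqE /= neq_ltn => /orP[il|li].
    by rewrite IHl // (leq_trans (ltnW il)).
  by rewrite ffactr_nat ffact_small // !mulr0.
by move/addIr; rewrite ffactr_nat ffactnn; apply: mulIf; exact: natr_fact_neq0.
Qed.

(** Makes the power law [dexp_nat] available for the binomial series. *)
Lemma binom_fpsE (R : realType) (x : R) : binom_fps x = dexp 1 x.
Proof.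
apply: fpsP => n /=; congr (_ / _).
by apply: eq_bigr => i _; rewrite mulr1.
Qed.

Lemma binom_fps_1 (R : realType) : binom_fps (1 : R) = 1 + fpsX R.
Proof.
apply: fpsP => -[|[|n]]; rewrite /= /ffactr.
- by rewrite big_ord0 fact0 divr1 addr0.
- by rewrite big_ord1 subr0 divr1 add0r.
- by rewrite !big_ord_recl /= /bump subrr mul0r mulr0 mul0r addr0.
Qed.

(** Both sums of the theorem have this shape, with inner series g o g on the left and g on the
    right. *)
Lemma egf_coef_comp (R : realType) (f g : fps R) (n : nat) :
  egf_coef (fps_comp f g) n =
  \sum_(k < n.+1) egf_coef f k * egf_coef (k`!%:R^-1 *: g ^+ k) n.
Proof.
rewrite /egf_coef /= mulr_sumr; apply: eq_bigr => k _.
rewrite [RHS]mulrCA; congr (_ * _).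
by rewrite mulrACA mulfV ?natr_fact_neq0 // mul1r.
Qed.

(** * Substitution of e_lambda(t) - 1 *)

Section DegenerateStirling.
Variables (R : realType) (lambda : R).
Let g : fps R := dexp lambda 1 - 1.

Let g0 : fcoef g 0 = 0.
Proof. exact: dexpB1_coef0. Qed.

Lemma comp_1DX : fps_comp (1 + fpsX R) g = dexp lambda 1.
Proof. by rewrite fps_compD fps_comp1 fps_compX // addrC subrK. Qed.

Lemma dffactr_egf (x : R) (n : nat) :
  dffactr lambda x n = egf_coef (dexp lambda x) n.
Proof. by rewrite /egf_coef /= mulrC divfK // natr_fact_neq0. Qed.

Lemma ffactr_egf (x : R) (n : nat) : ffactr x n = egf_coef (binom_fps x) n.
Proof. by rewrite /egf_coef /= mulrC divfK // natr_fact_neq0. Qed.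

(* For natural x the identity (1 + t)^x o g = e_lambda^x(t) is the
   multiplicativity of composition; it determines the coefficients
   S_2(n, l), which are independent of x. *)
Lemma dstirling2_egf (n l : nat) : (l <= n)%N ->
  dstirling2 lambda n l = egf_coef (l`!%:R^-1 *: g ^+ l) n.
Proof.
move: l; apply: (@ffactr_free _ n) => m.
rewrite -dstirling2P dffactr_egf dexp_nat -comp_1DX -fps_compXn //.
rewrite -binom_fps_1 binom_fpsE -dexp_nat -binom_fpsE egf_coef_comp.
by apply: eq_bigr => k _; rewrite -ffactr_egf mulrC.
Qed.

(** The coefficients S_2(n, l), identified through natural exponents, serve every real x in
    [dstirling2P]. *)
Lemma comp_binom_fps (x : R) : fps_comp (binom_fps x) g = dexp lambda x.
Proof.
apply: fpsP => n; apply: (mulfI (natr_fact_neq0 R n)).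
rewrite -/(egf_coef _ n) -/(egf_coef _ n) -dffactr_egf dstirling2P.
rewrite egf_coef_comp; apply: eq_bigr => k _.
have le_kn : (k <= n)%N by rewrite -ltnS.
by rewrite (dstirling2_egf le_kn) -ffactr_egf mulrC.
Qed.

(** Substitution respects sums, products, powers and inverses of units, and sends 1 + t to
    e_lambda(t). *)
Lemma comp_changhee2_fps (r : nat) (x : R) :
  fps_comp ((2 / ((1 + fpsX R) + (1 + fpsX R)^-1)) ^+ r * binom_fps x) g =
  (2 / (dexp lambda 1 + dexp lambda (-1))) ^+ r * dexp lambda x.
Proof.
set u := 1 + fpsX R.
have u0 : fcoef u 0 = 1 by rewrite /= addr0.
have Uu : u \is a GRing.unit by rewrite fps_unitE u0 unitr1.
have uV0 : fcoef u^-1 0 = 1.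
  have := congr1 (fun f : fps R => fcoef f 0) (divrr Uu).
  by rewrite fcoefM big_ord1 u0 mul1r.
(* The constant term is 1 + 1 = 2, invertible in the reals. *)
have Us : u + u^-1 \is a GRing.unit.
  by rewrite fps_unitE fcoefD u0 uV0 unitfE -[1 + 1]/(2%:R) pnatr_eq0.
have comp2 : fps_comp 2 g = 2.
  by rewrite -[2]/(1 + 1 : fps R) fps_compD fps_comp1.
have compu : fps_comp (u + u^-1) g = dexp lambda 1 + dexp lambda (-1).
  by rewrite fps_compD (fps_compV g0 Uu) comp_1DX dexpN1.
rewrite (fps_compM _ _ g0) (fps_compXn _ _ g0) (fps_compM _ _ g0) comp2.
by rewrite (fps_compV g0 Us) compu comp_binom_fps.
Qed.

End DegenerateStirling.

Theorem theorem8 (R : realType) (lambda : R) (lambda_neq0 : lambda != 0)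
    (r : nat) (r_gt0 : (0 < r)%N) (n : nat) (x : R) :
  \sum_(k < n.+1) jstirling2 lambda n k * changhee2 r k x =
  \sum_(k < n.+1) deuler2 lambda r k x * dstirling2 lambda n k.
Proof.
have g0 := dexpB1_coef0 lambda.
transitivity (egf_coef (fps_comp
    ((2 / (dexp lambda 1 + dexp lambda (-1))) ^+ r * dexp lambda x)
    (dexp lambda 1 - 1)) n).
  (* Associativity turns (F o g) o g into F o (g o g), where g o g = e_lambda(e_lambda(t) - 1) - 1
     is the series defining [jstirling2]. *)
  rewrite -comp_changhee2_fps -fps_compA // fps_compB fps_comp1 egf_coef_comp.
  by apply: eq_bigr => k _; rewrite mulrC.
rewrite egf_coef_comp; apply: eq_bigr => k _.
have le_kn : (k <= n)%N by rewrite -ltnS.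
by rewrite (dstirling2_egf lambda le_kn).
Qed.
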